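(* For odd $p$ and even $m$, $$\sum_{n=1}^{\infty}\frac{\sum_{k=1}^{(p-1)/2}L_{2kmp^n}}{F_{mp^{n+1}}} = \frac{1}{F_{mp}}.$$
   Context: $F_n$ and $L_n$ denote the $n$-th Fibonacci and Lucas numbers: $F_n = \frac{\alpha^n-\beta^n}{\sqrt5}$ and $L_n=\alpha^n+\beta^n$, where $\alpha=\frac{1+\sqrt5}{2}$ and $\beta=\frac{1-\sqrt5}{2}$.
   Formalization: p and m are taken to be positive integers with p > 1: for p = 1 the inner sums are empty, so the left side is 0 while the right side is 1/F_m, and for m = 0 the denominators F_0 vanish. *)

(* Defs.v *)
From Stdlib Require Import Reals Arith.
From Coquelicot Require Import Coquelicot.
Open Scope R_scope.

Definition alpha : R := (1 + sqrt 5) / 2.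
Definition beta : R := (1 - sqrt 5) / 2.

Definition fibonacci (n : nat) : R := (alpha ^ n - beta ^ n) / sqrt 5.
Definition lucas (n : nat) : R := alpha ^ n + beta ^ n.

(* Main.v *)
Require Import Defs.
From Stdlib Require Import Reals Arith Lra Lia.
From Coquelicot Require Import Coquelicot.
Open Scope R_scope.

(** For even [N], [F_N * L_(2kN) = F_((2k+1)N) - F_((2k-1)N)], so the inner sum
    telescopes to [(F_(pN) - F_N) / F_N].  With [N = m p^n] the [n]-th term is
    [1/F_(m p^n) - 1/F_(m p^(n+1))], which telescopes again, and [1/F_j] tends
    to [0]. *)

Lemma sqrt5_sqr : sqrt 5 * sqrt 5 = 5.
Proof. apply sqrt_sqrt; lra. Qed.

Lemma sqrt5_bounds : 2 < sqrt 5 < 3.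
Proof.
  pose proof sqrt5_sqr as H; pose proof (sqrt_pos 5) as H0; split; nra.
Qed.

(** As [alpha * beta = -1], an even exponent removes the sign; this is where the parity of [m]
    enters. *)
Lemma alpha_beta_pow_even (n : nat) : Nat.Even n -> alpha ^ n * beta ^ n = 1.
Proof.
  intros [j ->].
  rewrite <- Rpow_mult_distr, pow_mult.
  replace ((alpha * beta) ^ 2) with 1; [apply pow1|].
  assert (H : alpha * beta = -1).
  { unfold alpha, beta; pose proof sqrt5_sqr; lra. }
  rewrite H; ring.
Qed.

(** Bernoulli's inequality bounds [alpha ^ n] below, while [beta ^ n] stays at most 1. This crude
    linear bound yields both positivity and divergence. *)
Lemma fibonacci_ge (n : nat) : INR n / 4 <= fibonacci n.
Proof.
  pose proof sqrt5_bounds as Hs.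
  assert (Ha : 1 + INR n * ((sqrt 5 - 1) / 2) <= alpha ^ n).
  { replace alpha with (1 + (sqrt 5 - 1) / 2) by (unfold alpha; lra).
    destruct n as [|n]; [simpl; lra|].
    apply poly; lra. }
  assert (Hb : beta ^ n <= 1).
  { apply Rle_trans with (1 := Rle_abs _).
    rewrite <- RPow_abs, <- (pow1 n).
    apply pow_incr; split; [apply Rabs_pos|].
    apply Rabs_le; unfold beta; lra. }
  unfold fibonacci.
  apply (Rle_div_r _ _ (sqrt 5)); [lra|].
  (* The constant 1/4 works because [sqrt 5 / 4 <= (sqrt 5 - 1) / 2] amounts to [2 <= sqrt 5]. *)
  assert (0 <= INR n * (sqrt 5 - 2)) by (apply Rmult_le_pos; [apply pos_INR|lra]).
  lra.
Qed.

Lemma fibonacci_pos (n : nat) : (0 < n)%nat -> 0 < fibonacci n.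
Proof.
  intros Hn; pose proof (fibonacci_ge n); apply lt_0_INR in Hn; lra.
Qed.

(** When [a * b = 1], the cross terms of [(a - b) * (a ^ (2k) + b ^ (2k))] drop to exponent
    [2k - 1], leaving a difference of consecutive odd-power terms. It is meant for [a = alpha ^ N],
    [b = beta ^ N]. *)
Lemma telescope_even_powers (a b : R) (q : nat) : a * b = 1 ->
  (a - b) * sum_n_m (fun k => a ^ (2 * k) + b ^ (2 * k)) 1 q
  = a ^ (2 * q + 1) - b ^ (2 * q + 1) - (a - b).
Proof.
  intros Hab; induction q as [|q IH].
  - rewrite sum_n_m_zero by lia; change (@zero _) with 0; simpl; ring.
  - rewrite sum_n_Sm by lia; change plus with Rplus.
    rewrite Rmult_plus_distr_l, IH.
    replace (2 * S q + 1)%nat with (S (S (S (2 * q)))) by lia.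
    replace (2 * S q)%nat with (S (S (2 * q))) by lia.
    replace (2 * q + 1)%nat with (S (2 * q)) by lia.
    rewrite <- !tech_pow_Rmult.
    generalize (a ^ (2 * q)) (b ^ (2 * q)); intros x y.
    (* Expand so that each cross term shows the factor [a * b], ready to be rewritten to 1. *)
    transitivity (a * x - b * y + (a * (a * (a * x)) - b * (b * (b * y)))
      - (a - b) + (a * b) * (b * y) - (a * b) * (a * x)); [ring|].
    rewrite Hab; ring.
Qed.

Lemma fibonacci_mul_sum_lucas (n q : nat) : Nat.Even n ->
  fibonacci n * sum_n_m (fun k => lucas (2 * k * n)) 1 q
  = fibonacci ((2 * q + 1) * n) - fibonacci n.
Proof.
  intros Hn.
  pose proof (telescope_even_powers _ _ q (alpha_beta_pow_even n Hn)) as H.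
  rewrite (sum_n_m_ext _ (fun k => (alpha ^ n) ^ (2 * k) + (beta ^ n) ^ (2 * k))).
  2:{ intros k; unfold lucas; rewrite <- !pow_mult, (Nat.mul_comm n); reflexivity. }
  unfold fibonacci.
  rewrite (Nat.mul_comm _ n), !pow_mult.
  pose proof sqrt5_bounds.
  unfold Rdiv at 1; rewrite Rmult_assoc, (Rmult_comm (/ sqrt 5)), <- Rmult_assoc, H.
  field; lra.
Qed.

Lemma is_series_telescope (u : nat -> R) : is_lim_seq u 0 ->
  is_series (fun i => u i - u (S i)) (u 0%nat).
Proof.
  intros Hu.
  change (is_lim_seq (sum_n (fun i => u i - u (S i))) (u 0%nat)).
  (* [sum_n] includes the index [n], so the surviving tail is [u (S n)]. *)
  apply is_lim_seq_ext with (fun n => u 0%nat - u (S n)).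
  - induction n as [|n IH]; [now rewrite sum_O|].
    rewrite sum_Sn, <- IH; change plus with Rplus; simpl; ring.
  - replace (Finite (u 0%nat)) with (Finite (u 0%nat - 0)) by (f_equal; ring).
    apply is_lim_seq_minus'; [apply is_lim_seq_const|].
    now apply is_lim_seq_incr_1 in Hu.
Qed.

Lemma is_lim_seq_inv_fibonacci (f : nat -> nat) : (forall i, (i <= f i)%nat) ->
  is_lim_seq (fun i => 1 / fibonacci (f i)) 0.
Proof.
  intros Hf.
  apply is_lim_seq_ext with (fun i => / fibonacci (f i)).
  { intros i; unfold Rdiv; ring. }
  apply (is_lim_seq_inv _ p_infty); [|discriminate].
  apply is_lim_seq_le_p_loc with (fun i => / 4 * INR i).
  - exists 0%nat; intros i _.
    pose proof (fibonacci_ge (f i)); pose proof (le_INR _ _ (Hf i)); lra.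
  - replace p_infty with (Rbar_mult (/ 4) p_infty).
    + apply is_lim_seq_scal_l, is_lim_seq_INR.
    + apply is_Rbar_mult_unique, is_Rbar_mult_sym, is_Rbar_mult_p_infty_pos.
      simpl; lra.
Qed.

(* [is_series] sums from index 0, so the summation index n >= 1 is [S i]. *)
Theorem theorem7 (p m : nat)
    (hp : Nat.Odd p) (hp1 : (1 < p)%nat) (hm : Nat.Even m) (hm0 : (0 < m)%nat) :
  is_series
    (fun i : nat =>
       let n := S i in
       sum_n_m (fun k : nat => lucas (2 * k * m * p ^ n)) 1 ((p - 1) / 2)
         / fibonacci (m * p ^ (n + 1)))
    (1 / fibonacci (m * p)).
Proof.
  (* The exponent [S i] is the index [n] of the series, so [u 0] is the claimed sum. *)
  set (u i := 1 / fibonacci (m * p ^ S i)).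
  replace (1 / fibonacci (m * p)) with (u 0%nat)
    by (unfold u; now rewrite Nat.pow_1_r).
  apply is_series_ext with (fun i => u i - u (S i)).
  - intros i; cbv zeta; unfold u.
    replace (S i + 1)%nat with (S (S i)) by lia.
    rewrite (sum_n_m_ext _ (fun k => lucas (2 * k * (m * p ^ S i))))
      by (intros k; now rewrite Nat.mul_assoc).
    (* Oddness of [p] makes the truncated division exact. *)
    assert (Hp : (2 * ((p - 1) / 2) + 1)%nat = p).
    { destruct hp as [q ->].
      replace (2 * q + 1 - 1)%nat with (q * 2)%nat by lia.
      rewrite Nat.div_mul; lia. }
    assert (HN : (0 < m * p ^ S i)%nat).
    { apply Nat.mul_pos_pos; [lia|]; apply Nat.neq_0_lt_0, Nat.pow_nonzero; lia. }
    assert (HE : Nat.Even (m * p ^ S i)).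
    { destruct hm as [j ->]; exists (j * p ^ S i)%nat; lia. }
    pose proof (fibonacci_mul_sum_lucas _ ((p - 1) / 2) HE) as H.
    rewrite Hp in H.
    rewrite (Nat.pow_succ_r' p (S i)).
    replace (m * (p * p ^ S i))%nat with (p * (m * p ^ S i))%nat by lia.
    revert H HN; generalize (m * p ^ S i)%nat; intros N H HN.
    pose proof (fibonacci_pos N HN) as H1.
    assert (H2 : 0 < fibonacci (p * N)) by (apply fibonacci_pos; nia).
    (* Multiplying by [fibonacci N] exposes the product in [H]; both sides become
       [1 - fibonacci N / fibonacci (p * N)]. *)
    apply Rmult_eq_reg_l with (fibonacci N); [|lra].
    unfold Rdiv at 3; rewrite <- Rmult_assoc, H.
    field; lra.
  - apply is_series_telescope.
    apply (is_lim_seq_inv_fibonacci (fun i => m * p ^ S i)%nat); intros i.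
    (* From [1 < p], [p ^ S i] exceeds [S i], and the positive factor [m] keeps the index above
       [i]. *)
    pose proof (Nat.pow_gt_lin_r p (S i) hp1); nia.
Qed.
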